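(* Let $F_n$ be the friendship graph consisting of $n$ triangles sharing a common vertex. Then $N_{sp}(F_n)=2^n$.
   Context: All graphs are finite, simple, undirected. For $S\subseteq V(G)$, $\overline{S}=V(G)\setminus S$ and $N(v)$ denotes the open neighbourhood of $v$. A set $S$ is a super dominating set of $G$ if every vertex of $\overline{S}$ has a neighbour in $S$ and for every $u\in\overline{S}$ there is $v\in S$ with $N(v)\cap\overline{S}=\{u\}$. The super domination number $\gamma_{sp}(G)$ is the minimum cardinality of a super dominating set of $G$. $N_{sp}(G)$ denotes the number of super dominating sets of $G$ of cardinality $\gamma_{sp}(G)$. The friendship graph $F_n$ ($n\in\mathbb{N}$) is the collection of $n$ triangles all sharing one common (central) vertex and otherwise disjoint; it has $2n+1$ vertices.
   Formalization: The case n = 1 is excluded: F_1 is a single triangle, whose super domination number is 2 and all three 2-element vertex sets are super dominating, so N_sp(F_1) = 3, not 2. *)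

(* Defs.v *)
From mathcomp Require Import all_boot.

Set Implicit Arguments.
Unset Strict Implicit.
Unset Printing Implicit Defensive.

Record sgraph := SGraph {
  svertex :> finType;
  sedge : rel svertex;
  sedge_sym : symmetric sedge;
  sedge_irrefl : irreflexive sedge }.

Definition open_neigh (G : sgraph) (v : G) : {set G} := [set w | sedge v w].

Notation "''N' ( v )" := (open_neigh v) (at level 8, format "''N' ( v )").

Definition dominating (G : sgraph) (S : {set G}) : bool :=
  [forall u in ~: S, exists v in S, sedge u v].

Definition super_dominating (G : sgraph) (S : {set G}) : bool :=
  dominating S &&
  [forall u in ~: S, exists v in S, 'N(v) :&: ~: S == [set u]].

Definition gamma_sp (G : sgraph) : nat :=
  #|[arg min_(S < [set: G] | super_dominating S) #|S| ]|.

Definition N_sp (G : sgraph) : nat :=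
  #|[set S : {set G} | super_dominating S & #|S| == gamma_sp G]|.

(* The value of [arg min_] is only meaningful because the whole vertex set is
   super dominating; [gamma_sp_attained] and [gamma_sp_min] then say that
   [gamma_sp] is the minimum. *)
Lemma super_dominatingT (G : sgraph) : super_dominating [set: G].
Proof.
by apply/andP; split; apply/forall_inP => u; rewrite setCT inE.
Qed.

Lemma gamma_sp_attained (G : sgraph) :
  exists2 S : {set G}, super_dominating S & #|S| = gamma_sp G.
Proof.
rewrite /gamma_sp; case: arg_minnP => [|S sdS _]; first exact: super_dominatingT.
by exists S.
Qed.

Lemma gamma_sp_min (G : sgraph) (S : {set G}) :
  super_dominating S -> gamma_sp G <= #|S|.
Proof.
rewrite /gamma_sp; case: arg_minnP => [|S0 _ minS0]; first exact: super_dominatingT.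
exact: minS0.
Qed.

(* [None] is the centre; [Some (i, false)] and [Some (i, true)] are the two
   other vertices of the [i]-th triangle. *)
Definition friendship_vertex (n : nat) : finType := option ('I_n * bool)%type.

Definition friendship_rel (n : nat) : rel (friendship_vertex n) :=
  fun x y =>
    match x, y with
    | None, None => false
    | None, Some _ | Some _, None => true
    | Some (i, b), Some (j, c) => (i == j) && (b != c)
    end.

Lemma friendship_sym (n : nat) : symmetric (@friendship_rel n).
Proof.
by case=> [[i b]|] [[j c]|] //=; rewrite eq_sym [c == b]eq_sym.
Qed.

Lemma friendship_irrefl (n : nat) : irreflexive (@friendship_rel n).
Proof. by case=> [[i b]|] //=; rewrite !eqxx. Qed.

Definition friendship (n : nat) : sgraph :=
  SGraph (@friendship_sym n) (@friendship_irrefl n).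

(* Main.v *)
Require Import Defs.
From mathcomp Require Import all_boot.

(** Let T be the complement of a super dominating set S; every u in T has a
    neighbour in S whose only neighbour in T is u.  If the centre lies in T, it
    is adjacent to every vertex of S, so no other vertex of T can have such a
    private neighbour and T is the centre alone; that private neighbour of the
    centre also forces n > 0, hence n > 1 and #|T| < n.  If the centre lies in S,
    two vertices of T in the same triangle would both need the centre as
    private neighbour; so T has at most one vertex in each triangle, and
    #|T| <= n with equality exactly when T chooses one vertex in each.  All
    2 ^ n choices do yield super dominating sets. *)

Lemma private_neighbour (G : sgraph) (S : {set G}) (u : G) :
  super_dominating S -> u \notin S ->
  exists v : G, [/\ v \in S, sedge v u &
    forall w : G, sedge v w -> w \notin S -> w = u].
Proof.
case/andP=> _ /forall_inP privS uS.
have /exists_inP[v vS /eqP Nv] : [exists v in S, 'N(v) :&: ~: S == [set u]].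
  by apply: privS; rewrite inE.
exists v; split=> // [|w vw wS].
  by have := set11 u; rewrite -Nv !inE => /andP[].
by apply/set1P; rewrite -Nv !inE vw.
Qed.

Definition omit_side (n : nat) (f : {ffun 'I_n -> bool}) :
    {set friendship n} :=
  [set x : friendship n | if x is Some (i, b) then b != f i else true].

Lemma setC_omit_side (n : nat) (f : {ffun 'I_n -> bool}) :
  ~: omit_side n f = [set (Some (i, f i) : friendship n) | i : 'I_n].
Proof.
apply/setP=> x; rewrite !inE; apply/idP/imsetP => [|[i _ ->]]; last first.
  by rewrite eqxx.
by case: x => [[i b]|] //= /negPn/eqP->; exists i.
Qed.

Lemma card_setC_omit_side (n : nat) (f : {ffun 'I_n -> bool}) :
  #|~: omit_side n f| = n.
Proof. by rewrite setC_omit_side card_imset ?card_ord // => i j [->]. Qed.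

Lemma card_friendship (n : nat) : #|friendship n| = n.*2.+1.
Proof. by rewrite card_option card_prod card_ord card_bool muln2. Qed.

Lemma card_omit_side (n : nat) (f : {ffun 'I_n -> bool}) :
  #|omit_side n f| = n.+1.
Proof.
have := cardsC (omit_side n f).
rewrite card_setC_omit_side card_friendship -addnn -addSn.
exact: addIn.
Qed.

Lemma omit_side_inj (n : nat) : injective (omit_side n).
Proof.
move=> f g /setP fg; apply/ffunP=> i.
by have := fg (Some (i, f i)); rewrite !inE eqxx => /esym/negPn/eqP.
Qed.

(** The centre dominates all omitted vertices. The private neighbour of an omitted vertex is its
    partner in the triangle, whose only other neighbour is the centre, which is kept. *)
Lemma super_dominating_omit_side (n : nat) (f : {ffun 'I_n -> bool}) :
  super_dominating (omit_side n f).
Proof.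
apply/andP; split; apply/forall_inP=> u; rewrite setC_omit_side.
  by case/imsetP=> i _ ->; apply/exists_inP; exists None; rewrite ?inE.
case/imsetP=> i _ ->; apply/exists_inP; exists (Some (i, ~~ f i)).
  by rewrite inE; case: (f i).
apply/eqP/setP=> x; rewrite -setC_omit_side !inE.
case: x => [[j b]|] //=.
apply/andP/eqP=> [[/andP[/eqP<- _] /negPn/eqP->] // | [-> ->]].
by rewrite !eqxx; case: (f i).
Qed.

(** This fails for [n = 1]: in a single triangle the centre alone may be omitted. *)
Lemma centre_in_large_super_dominating (n : nat) (S : {set friendship n}) :
  n <> 1 -> super_dominating S -> n <= #|~: S| -> None \in S.
Proof.
move=> n1 sdS nT; apply: contraT => cS.
have T1 : ~: S \subset [set (None : friendship n)].
  apply/subsetP=> u; rewrite !inE => uS; apply/eqP.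
  have [v [vS _ vP]] := private_neighbour _ _ _ sdS uS.
  by apply/esym/vP => //; case: v vS {vP} => [[] //|]; rewrite (negPf cS).
have := leq_trans nT (subset_leq_card T1); rewrite cards1.
(* The private neighbour of the centre lies in some triangle [i], so ['I_n] is inhabited; with
   [n <= 1] this leaves only the excluded [n = 1]. *)
have [[[i b]|] [_ //= _ _]] := private_neighbour _ _ _ sdS cS.
by case: n i {S sdS nT cS T1 b} n1 => [[] | [|n]].
Qed.

Lemma same_triangle_omitted (n : nat) (S : {set friendship n}) i b c :
  super_dominating S -> None \in S ->
  Some (i, b) \notin S -> Some (i, c) \notin S -> b = c.
Proof.
move=> sdS cS bS dS.
have [[[j d]|] [vS /= e vP]] := private_neighbour _ _ _ sdS bS; last first.
  by have [->] := vP (Some (i, c)) isT dS.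
(* Here the private neighbour is the partner of [(i, b)] and lies in [S], so [c] cannot be its
   side. *)
case/andP: e => /eqP ji db; rewrite ji in vS.
by case: b c d bS dS vS db {vP} => [] [] [] // ? /negPf->.
Qed.

Lemma large_super_dominating (n : nat) (S : {set friendship n}) :
  n <> 1 -> super_dominating S -> n <= #|~: S| ->
  exists f, S = omit_side n f.
Proof.
move=> n1 sdS nT; have cS := centre_in_large_super_dominating n S n1 sdS nT.
pose triangle (x : friendship n) : option 'I_n := omap fst x.
have triangle_inj : {in ~: S &, injective triangle}.
  move=> [[i b]|] [[j c]|] //=; rewrite !inE ?cS // => bS dS [ij].
  by move: dS; rewrite -ij => /(same_triangle_omitted n S i b c sdS cS bS) ->.
(* By injectivity the image has at least [n] elements, so every triangle is hit. *)
have triangleT : triangle @: (~: S) = [set Some i | i : 'I_n].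
  apply/eqP; rewrite eqEcard card_in_imset // card_imset; last by move=> ? ? [].
  rewrite card_ord nT andbT; apply/subsetP=> _ /imsetP[[[i b]|] xS ->].
    exact: imset_f.
  by rewrite inE cS in xS.
have hit i : exists b, Some (i, b) \notin S.
  have : Some i \in triangle @: (~: S) by rewrite triangleT imset_f.
  by case/imsetP=> [[[j b]|]] //; rewrite inE => bS [->]; exists b.
(* Exactly one side of each triangle is omitted, so this boolean is that side. *)
exists [ffun i => Some (i, true) \notin S].
apply/setP=> [[[i b]|]]; rewrite !inE ?ffunE //.
have [d dS] := hit i.
have := same_triangle_omitted n S i true false sdS cS.
case: b d dS => [] [] /negPf dS; rewrite ?dS //=; case: (_ \in S) => //=.
all: by move=> /(_ isT isT).
Qed.

Lemma gamma_sp_friendship (n : nat) : n <> 1 -> gamma_sp (friendship n) = n.+1.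
Proof.
move=> n1; have [S sdS Sg] := gamma_sp_attained (friendship n).
have := gamma_sp_min (super_dominating_omit_side n [ffun=> true]).
rewrite card_omit_side -Sg => leS.
suff /(large_super_dominating n S n1 sdS)[f ->] : n <= #|~: S|.
  exact: card_omit_side.
(* Of the [2n + 1] vertices at most [n + 1] lie in [S], so at least [n] are omitted. *)
by rewrite -(leq_add2l n.+1) addSn addnn -card_friendship -(cardsC S) leq_add2r.
Qed.

Theorem theorem6p2 (n : nat) (hn : n <> 1) : N_sp (friendship n) = 2 ^ n.
Proof.
rewrite /N_sp gamma_sp_friendship //.
have -> : [set S : {set friendship n} | super_dominating S & #|S| == n.+1]
    = [set omit_side n f | f : {ffun 'I_n -> bool}].
  apply/setP=> S; rewrite inE; apply/andP/imsetP => [[sdS /eqP cardS]|[f _ ->]].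
    have [|f ->] := large_super_dominating n S hn sdS; last by exists f.
    by rewrite cardsCs setCK card_friendship cardS subSS -addnn addnK.
  by rewrite super_dominating_omit_side card_omit_side eqxx.
by rewrite card_imset ?card_ffun ?card_bool ?card_ord //; apply: omit_side_inj.
Qed.
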